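(* Every smooth improper indefinite affine sphere is the generalized area distance of a pair of planar curves. Precisely: let $I_1,I_2\subset\mathbb{R}$ be intervals and let $q:I_1\times I_2\to\mathbb{R}^3$ be a smooth indefinite improper affine sphere parameterized by asymptotic coordinates $(s,t)$. After applying to $\mathbb{R}^3$ a unimodular affine transformation taking the constant affine normal to $(0,0,1)$ (the identity, if the affine normal is already $(0,0,1)$), and after interchanging the roles of $s$ and $t$ if necessary, there exist smooth plane curves $\alpha=\alpha(s)$ and $\beta=\beta(t)$ such that $q(s,t)=(\mathbf{x}(s,t),g(s,t))$ is the generalized area distance of the pair $(\alpha,\beta)$.
   Context: For vectors, $[\cdot,\cdot,\cdot]$ denotes the determinant in $\mathbb{R}^3$, and $(a,b)^\perp=(-b,a)$ is anticlockwise rotation by ninety degrees in $\mathbb{R}^2$. Subscripts $s,t$ denote partial derivatives. Generalized area distance: for $C^\infty$ plane curves $\alpha(s)$ and $\beta(t)$ defined on intervals, put $\mathbf{x}(s,t)=\frac12(\alpha(s)+\beta(t))$ and $\mathbf{n}(s,t)=\frac12(\beta(t)-\alpha(s))^{\perp}$. Let $g$ be the function, unique up to an additive constant, with $\nabla g=\mathbf{n}$, the gradient being taken with respect to $\mathbf{x}$; that is, $g_s=\mathbf{n}\cdot\mathbf{x}_s$ and $g_t=\mathbf{n}\cdot\mathbf{x}_t$. The map $(s,t)\mapsto(\mathbf{x}(s,t),g(s,t))$ is the generalized area distance of $(\alpha,\beta)$. Improper affine spheres: for an immersion $q(s,t)$ into $\mathbb{R}^3$ write $L=[q_s,q_t,q_{ss}]$,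 $M=[q_s,q_t,q_{st}]$, $N=[q_s,q_t,q_{tt}]$. The immersion is indefinite if $LN-M^2<0$; $(s,t)$ are asymptotic coordinates if $L=N=0$. In asymptotic coordinates the affine normal is $\xi=q_{st}/\Omega$ with $\Omega=\sqrt{M}$, where $M>0$ is arranged by exchanging $s$ and $t$ if necessary ($\xi$ is defined up to sign, according to orientation). The immersion is an improper affine sphere if $\xi$ is a constant vector field. A unimodular affine transformation is one whose linear part has determinant $1$. *)

(* Defs.v *)
From HB Require Import structures.
From mathcomp Require Import all_boot all_order all_algebra.
From mathcomp Require Import all_classical all_reals all_analysis.

Set Implicit Arguments.
Unset Strict Implicit.
Unset Printing Implicit Defensive.

Import Order.TTheory GRing.Theory Num.Theory.
Import numFieldNormedType.Exports.

Local Open Scope classical_set_scope.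
Local Open Scope ring_scope.

Section Smooth.
Context {R : realType} {V W : normedModType R}.

Definition iter_derive (vs : seq V) (f : V -> W) : V -> W :=
  foldr (fun v h => 'D_v h) f vs.

(* C^oo on a set A that need not be open: f is C^oo on some open neighbourhood
   of A.  Functions are total, so f also plays the part of the extension; its
   values outside U are irrelevant.  For finite-dimensional V, differentiability
   of all iterated directional derivatives on U is the usual C^oo. *)
Definition smooth_on (A : set V) (f : V -> W) : Prop :=
  exists U : set V, [/\ open U, A `<=` U &
    forall (vs : seq V) (p : V), U p -> differentiable (iter_derive vs f) p].

End Smooth.

(* Open, closed, half-open or unbounded, but not empty nor a single point. *)
Definition nondegenerate_interval {R : realType} (I : set R) : Prop :=
  is_interval I /\ exists a b : R, [/\ I a, I b & a < b].

Section SurfacePatches.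
Context {R : realType}.

Definition ds {W : normedModType R} (f : R * R -> W) : R * R -> W :=
  'D_((1, 0) : R * R) f.
Definition dt {W : normedModType R} (f : R * R -> W) : R * R -> W :=
  'D_((0, 1) : R * R) f.

Definition vec2 (a b : R) : 'rV[R]_2 := \row_(i < 2) [:: a; b]`_i.
Definition vec3 (a b c : R) : 'rV[R]_3 := \row_(i < 3) [:: a; b; c]`_i.

Definition det3 (u v w : 'rV[R]_3) : R :=
  \det (\matrix_(i < 3) [:: u; v; w]`_i).

Definition dotp (u v : 'rV[R]_2) : R := \sum_(i < 2) u 0 i * v 0 i.

Definition perp (u : 'rV[R]_2) : 'rV[R]_2 := vec2 (- u 0 1) (u 0 0).

Section AreaDistance.
Variables alpha beta : R -> 'rV[R]_2.

Definition midpoint (p : R * R) : 'rV[R]_2 :=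
  2^-1 *: (alpha p.1 + beta p.2).

Definition half_chord_perp (p : R * R) : 'rV[R]_2 :=
  2^-1 *: perp (beta p.2 - alpha p.1).

Definition is_area_function (I1 I2 : set R) (g : R * R -> R) : Prop :=
  smooth_on (I1 `*` I2) g /\
  forall p, (I1 `*` I2) p ->
    ds g p = dotp (half_chord_perp p) (ds midpoint p) /\
    dt g p = dotp (half_chord_perp p) (dt midpoint p).

Definition generalized_area_distance (I1 I2 : set R) (r : R * R -> 'rV[R]_3)
    : Prop :=
  exists g : R * R -> R, is_area_function I1 I2 g /\
    forall p, (I1 `*` I2) p ->
      r p = vec3 (midpoint p 0 0) (midpoint p 0 1) (g p).

End AreaDistance.

Definition exchange (p : R * R) : R * R := (p.2, p.1).

Section AffineSpheres.
Variable q : R * R -> 'rV[R]_3.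

Definition Lcoef (p : R * R) : R := det3 (ds q p) (dt q p) (ds (ds q) p).
Definition Mcoef (p : R * R) : R := det3 (ds q p) (dt q p) (dt (ds q) p).
Definition Ncoef (p : R * R) : R := det3 (ds q p) (dt q p) (dt (dt q) p).

Definition immersion_on (D : set (R * R)) : Prop :=
  smooth_on D q /\ forall p, D p -> row_free (col_mx (ds q p) (dt q p)).

Definition indefinite_on (D : set (R * R)) : Prop :=
  forall p, D p -> Lcoef p * Ncoef p - Mcoef p ^+ 2 < 0.

Definition asymptotic_on (D : set (R * R)) : Prop :=
  forall p, D p -> Lcoef p = 0 /\ Ncoef p = 0.

(* q_st / Omega, meaningful where M > 0. *)
Definition affine_normal_Mpos (p : R * R) : 'rV[R]_3 :=
  (Num.sqrt (Mcoef p))^-1 *: dt (ds q) p.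

End AffineSpheres.

(* In asymptotic coordinates; where M < 0, the roles of s and t are exchanged
   first, which makes M positive. *)
Definition affine_normal (q : R * R -> 'rV[R]_3) (p : R * R) : 'rV[R]_3 :=
  if 0 < Mcoef q p then affine_normal_Mpos q p
  else affine_normal_Mpos (q \o exchange) (exchange p).

(* The affine normal is only defined up to a global sign (orientation), so xi
   and - xi are both admitted. *)
Definition constant_affine_normal (D : set (R * R)) (q : R * R -> 'rV[R]_3)
    (xi : 'rV[R]_3) : Prop :=
  (forall p, D p -> affine_normal q p = xi) \/
  (forall p, D p -> affine_normal q p = - xi).

(* Smooth indefinite improper affine sphere, in asymptotic coordinates, with
   constant affine normal xi. *)
Definition indefinite_improper_affine_sphere (D : set (R * R))
    (q : R * R -> 'rV[R]_3) (xi : 'rV[R]_3) : Prop :=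
  [/\ immersion_on q D, indefinite_on q D, asymptotic_on q D &
      constant_affine_normal D q xi].

Definition affine_map (A : 'M[R]_3) (b v : 'rV[R]_3) : 'rV[R]_3 := v *m A + b.

End SurfacePatches.

(* Main.v *)
Require Import Defs.
From HB Require Import structures.
From mathcomp Require Import all_boot all_order all_algebra.
From mathcomp Require Import all_classical all_reals all_analysis.
From mathcomp Require Import ring lra.

Import Order.TTheory GRing.Theory Num.Theory.
Import numFieldNormedType.Exports.

Local Open Scope classical_set_scope.
Local Open Scope ring_scope.

(** Apply a unimodular map that makes the affine normal vertical and write the
    surface as (X, g) with X plane. Write [a, b] for the determinant of two plane
    vectors. Unwinding the definition of the affine normal gives
    q_st = sigma [q_s, q_t, xi] xi with sigma the sign of M, whatever the choice of
    sign of xi ([normal_reconstructs_mixed]); M does not vanish, so sigma is constant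
    on the rectangle ([constant_sign]). In the vertical position this says X_st = 0
    and g_st = sigma [X_s, X_t]. An area distance has g_st = [X_t, X_s], so the
    surface is used as it is when M < 0, and with s and t exchanged when M > 0.

    Since [X_s, X_t] does not vanish there is a unique plane vector field w with
    [w, X_s] = g_s and [w, X_t] = g_t. Differentiating these equations, and using
    X_st = 0, the value of g_st and L = N = 0, which say that the pure second
    derivatives lie in the tangent planes, one finds w_s = - X_s and w_t = X_t
    ([chord_ds], [chord_dt]). Hence X - w depends on s only and X + w on t only: they
    are the curves alpha and beta, X is their midpoint and w half of their chord, and
    the equations defining w say that the gradient of g is the half chord rotated by
    ninety degrees ([area_distance_of_planar_data]).

    The rectangle may contain boundary points, so equations that hold on it are
    integrated along coordinate segments ([separated_variables],
    [chord_integrated]), while smoothness provides derivatives on a neighbourhood.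
    Differentiating the equations for w needs the symmetry of second derivatives
    ([derive_commute]), obtained here from second differences. *)

(** * Directional derivatives and smooth functions *)

(** The form of [smooth_on] with the open set named: the components of a surface
    and its partial derivatives then share one neighbourhood. *)
Definition smooth_in {R : realType} {V W : normedModType R} (U : set V)
    (f : V -> W) : Prop :=
  forall (vs : seq V) (p : V), U p -> differentiable (iter_derive vs f) p.

Lemma smooth_in_differentiable {R : realType} {V W : normedModType R}
    {U : set V} {f : V -> W} {p : V} :
  smooth_in U f -> U p -> differentiable f p.
Proof. by move=> /(_ [::]); exact. Qed.

Lemma smooth_in_derive {R : realType} {V W : normedModType R} {U : set V}
    {f : V -> W} (v : V) :
  smooth_in U f -> smooth_in U ('D_v f).
Proof.
move=> fU vs p Up; have := fU (rcons vs v) p Up.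
by rewrite /iter_derive -cats1 foldr_cat.
Qed.

(** For an affine [phi] the difference quotients of [f \o phi] along [v] are
    exactly those of [f] along [L v], so the two derivatives are the same limit.
    Restriction to a coordinate line and exchange of variables are both of this
    kind. *)
Lemma derive_affine_precomp {R : realType} {V V' W : normedModType R}
    (phi L : V' -> V) (f : V -> W) (p v : V') :
  (forall (h : R) w a, phi (h *: w + a) = h *: L w + phi a) ->
  'D_v (f \o phi) p = 'D_(L v) f (phi p).
Proof.
move=> phiE; rewrite /derive /=.
by under eq_fun do rewrite phiE.
Qed.

Lemma is_derive_affine_precomp {R : realType} {V V' W : normedModType R}
    (phi L : V' -> V) (f : V -> W) (p v : V') (df : W) :
  (forall (h : R) w a, phi (h *: w + a) = h *: L w + phi a) ->
  is_derive (phi p) (L v) f df -> is_derive p v (f \o phi) df.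
Proof.
move=> phiE [fpL <-]; apply: DeriveDef; last exact: derive_affine_precomp.
move: fpL; rewrite /derivable /= => fpL.
by under eq_fun do rewrite phiE.
Qed.

Lemma is_derive_differentiable {R : realType} {V W : normedModType R}
    {f : V -> W} {p : V} (v : V) :
  differentiable f p -> is_derive p v f ('D_v f p).
Proof. by move=> df; apply: DeriveDef => //; exact: diff_derivable. Qed.

Lemma smooth_on_affine_precomp {R : realType} {V V' W : normedModType R}
    (phi : V' -> V) (L : V' -> V) (A : set V) (f : V -> W) :
  (forall (h : R) w a, phi (h *: w + a) = h *: L w + phi a) ->
  (forall p, differentiable phi p) ->
  smooth_on A f -> smooth_on (phi @^-1` A) (f \o phi).
Proof.
move=> phiE dphi [U [oU AU fU]]; exists (phi @^-1` U); split.
- by apply: open_comp => // p _; exact: differentiable_continuous.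
- by move=> p; exact: AU.
- move=> vs p Up.
  have -> : iter_derive vs (f \o phi) = iter_derive (map L vs) f \o phi.
    elim: vs => //= v vs ->; apply/funext => x.
    exact: derive_affine_precomp.
  by apply: differentiable_comp => //; exact: fU.
Qed.

(** The derivatives of [f] exist only on [U], so the identity holds on [U] and is
    carried through the iteration by locality of the derivative. *)
Lemma iter_derive_linear {R : realType} {V W W' : normedModType R}
    (l : {linear W -> W'}) (U : set V) (f : V -> W) :
  continuous l -> open U -> smooth_in U f ->
  forall vs p, U p -> iter_derive vs (l \o f) p = l (iter_derive vs f p).
Proof.
move=> lc oU fU; elim=> //= v vs ih p Up.
have -> : 'D_v (iter_derive vs (l \o f)) p = 'D_v (l \o iter_derive vs f) p.
  by apply: near_eq_derive; near do apply: ih; exact: open_nbhs_nbhs.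
have dl : forall x, differentiable l x by move=> x; exact: linear_differentiable.
have df := fU vs p Up.
rewrite (deriveE _ df) deriveE; last exact: differentiable_comp.
by rewrite diff_comp// diff_lin.
Unshelve. all: by end_near. Qed.

Lemma near_eq_differentiable {R : realType} {V W : normedModType R}
    (f g : V -> W) (p : V) :
  (\near p, f p = g p) -> differentiable f p -> differentiable g p.
Proof.
move=> fg /diff_locallyP[dfc] /eqaddoP fE.
have gE : g \o shift p = cst (g p) + 'd f p +o_ 0 id.
  apply/eqaddoP => e e0; have fEe := fE e e0.
  have fgp : f p = g p by exact: nbhs_singleton fg.
  have fgs : \forall y \near 0, f (y + p) = g (y + p).
    have : (y + p) @[y --> (0 : V)] --> p.
      rewrite -[X in _ --> X]add0r; apply: cvgD; [exact: cvg_id|exact: cvg_cst].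
    by move=> /(_ [set z | f z = g z] fg).
  near=> y.
  have fgy : f (y + p) = g (y + p) by near: y; exact: fgs.
  have : `|(f \o shift p - (cst (f p) + 'd f p)) y| <= e * `|y| by near: y.
  by rewrite !fctE/= fgy fgp.
by apply/diff_locallyP; rewrite (diff_unique dfc gE).
Unshelve. all: by end_near.
Qed.

Lemma smooth_in_linear {R : realType} {V W W' : normedModType R}
    (l : {linear W -> W'}) (U : set V) (f : V -> W) :
  continuous l -> open U -> smooth_in U f -> smooth_in U (l \o f).
Proof.
move=> lc oU fU vs p Up.
apply: (@near_eq_differentiable _ _ _ (l \o iter_derive vs f)).
  have : nbhs p U by exact: open_nbhs_nbhs.
  by apply: filterS => x Ux; rewrite /= (iter_derive_linear l _ _ lc oU fU).
apply: differentiable_comp; first exact: fU.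
exact: linear_differentiable.
Qed.

(** The innermost derivative removes the constant, whence the case split on the
    last direction of the sequence. *)
Lemma smooth_in_addr {R : realType} {V W : normedModType R}
    (U : set V) (f : V -> W) (c : W) :
  smooth_in U f -> smooth_in U (fun p => f p + c).
Proof.
move=> fU; case/lastP => [|vs v] p Up.
  by apply: differentiableD; [exact: (fU [::])|exact: differentiable_cst].
have -> : iter_derive (rcons vs v) (fun p => f p + c) = iter_derive (rcons vs v) f.
  rewrite /iter_derive -!cats1 !foldr_cat/=; congr foldr.
  apply/funext => x; rewrite /derive/=.
  by under eq_fun do rewrite opprD addrACA subrr addr0.
exact: fU.
Qed.

Lemma smooth_on_affine_postcomp {R : realType} {V W W' : normedModType R}
    (l : {linear W -> W'}) (c : W') (A : set V) (f : V -> W) :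
  continuous l -> smooth_on A f -> smooth_on A (fun p => l (f p) + c).
Proof.
move=> lc [U [oU AU fU]]; exists U; split => //.
by apply: smooth_in_addr; exact: smooth_in_linear.
Qed.

Lemma mulmxr_continuous {R : realType} {m n : nat} (B : 'M[R]_(m, n)) :
  continuous (mulmxr B : 'rV_m -> 'rV_n).
Proof.
move=> v; apply: differentiable_continuous.
have -> : (mulmxr B : 'rV_m -> 'rV_n) = \sum_(i < m) (fun v : 'rV_m => v 0 i *: row i B).
  by apply/funext => w; rewrite fct_sumE /= mulmx_sum_row.
apply: differentiable_sum => i.
by apply: differentiableZl; exact: differentiable_coord.
Qed.

Lemma rV_coord_linear {R : realType} {n : nat} (i : 'I_n) :
  exists2 l : {linear 'rV[R]_n -> R}, (forall v, l v = v 0 i) & continuous l.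
Proof.
have @f : {linear 'rV[R]_n -> R}.
  by exists (fun N : 'rV[R]_n => N 0 i); do 2![eexists]; do ?[constructor];
     rewrite ?mxE// => ? *; rewrite ?mxE//; move=> ?; rewrite !mxE.
by exists f => //; exact: coord_continuous.
Qed.

(** * Mean values and symmetry of second derivatives *)

Lemma dist_le_of_halves {R : realType} (a b m e : R) :
  `|a - m| < e / 2 -> `|b - m| < e / 2 -> `|a - b| <= e.
Proof.
move=> am bm; rewrite (le_trans (ler_distD m _ _))// [leRHS]splitr ltW//.
by rewrite ltrD// distrC.
Qed.

Lemma is_derive_line {R : realType} {V W : normedModType R} (f : V -> W)
    (a u : V) (s : R) :
  differentiable f (s *: u + a) ->
  is_derive s 1 (fun r : R => f (r *: u + a)) ('D_u f (s *: u + a)).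
Proof.
move=> df.
have := @is_derive_affine_precomp R V R^o W (fun r => r *: u + a)
  (fun r => r *: u) f s 1 ('D_u f (s *: u + a)).
rewrite scale1r; apply => [h w b /=|].
  by rewrite scalerDl scalerA addrA.
exact: is_derive_differentiable.
Qed.

Lemma MVT_line {R : realType} {V : normedModType R} (f : V -> R) (a u : V)
    (h : R) : 0 < h ->
  (forall c : R, 0 <= c <= h -> differentiable f (c *: u + a)) ->
  exists2 c : R, 0 <= c <= h & f (h *: u + a) - f a = h * 'D_u f (c *: u + a).
Proof.
move=> h0 df.
have dfl c : c \in `[0, h] ->
    is_derive c 1 (fun r : R => f (r *: u + a)) ('D_u f (c *: u + a)).
  by rewrite in_itv/= => c0h; apply: is_derive_line; exact: df.
have cfl : {within `[0, h], continuous (fun r : R => f (r *: u + a))}.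
  by apply: derivable_within_continuous => c /dfl[].
have dfl' c : c \in `]0, h[ ->
    is_derive c 1 (fun r : R => f (r *: u + a)) ('D_u f (c *: u + a)).
  by move=> c0h; apply: dfl; exact: subset_itv_oo_cc c0h.
have [c] := MVT_segment (ltW h0) dfl' cfl.
rewrite in_itv/= scale0r add0r subr0 mulrC => c0h ->.
by exists c.
Qed.

Lemma is_derive0_interval_cst {R : realType} (I : set R) (h : R -> R) :
  is_interval I -> (forall s, I s -> is_derive s 1 h 0) ->
  forall a b, I a -> I b -> h a = h b.
Proof.
move=> itvI dh.
suff cst_lt a b : I a -> I b -> a < b -> h a = h b.
  by move=> a b Ia Ib; case: (ltgtP a b) => [/cst_lt->|/cst_lt->|->].
move=> Ia Ib ab.
have dab c : c \in `[a, b] -> is_derive c 1 h 0.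
  by rewrite in_itv/= => cab; apply: dh; exact: itvI cab.
have ch : {within `[a, b], continuous h}.
  by apply: derivable_within_continuous => c /dab[].
have dab' c : c \in `]a, b[ -> is_derive c 1 h 0.
  by move=> cab; apply: dab; exact: subset_itv_oo_cc cab.
have [c _] := MVT_segment (ltW ab) dab' ch.
by rewrite mul0r => /eqP; rewrite subr_eq0 => /eqP.
Qed.

(** The mean value theorem applied twice: along [u] to a difference of
    [f] in the direction [v], then along [v] to ['D_u f]. *)
Lemma second_difference {R : realType} {V : normedModType R} (U : set V)
    (f : V -> R) (p u v : V) (h : R) : 0 < h -> smooth_in U f ->
  (forall c d : R, 0 <= c <= h -> 0 <= d <= h -> U (c *: u + (d *: v + p))) ->
  exists c d : R, [/\ 0 <= c <= h, 0 <= d <= h &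
    f (h *: u + (h *: v + p)) - f (h *: u + p) - f (h *: v + p) + f p =
    h ^+ 2 * 'D_v ('D_u f) (c *: u + (d *: v + p))].
Proof.
move=> h0 fU Usq.
have hh : 0 <= h <= h by rewrite lexx ltW.
have zh : (0 : R) <= 0 <= h by rewrite lexx ltW.
have dF (k : V -> R) (c d : R) : 0 <= c <= h -> 0 <= d <= h -> smooth_in U k ->
    differentiable k (c *: u + (d *: v + p)).
  by move=> c0h d0h kU; apply: smooth_in_differentiable kU _; exact: Usq.
have shiftE (q : V) : q = (0 : R) *: v + q by rewrite scale0r add0r.
have derF (c : R) : 0 <= c <= h -> forall d : R, 0 <= d <= h ->
    is_derive (c *: u + p) u (fun q => f (q + d *: v)) ('D_u f (c *: u + (d *: v + p))).
  move=> c0h d0 d0h.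
  have := @is_derive_affine_precomp R V V R (fun q => q + d0 *: v) id f
    (c *: u + p) u ('D_u f (c *: u + (d0 *: v + p))).
  rewrite -addrA [p + _]addrC; apply; last first.
    by apply: is_derive_differentiable; exact: dF.
  by move=> k w a; rewrite addrA.
pose F q := f (q + h *: v) - f q.
have diffF (c : R) : 0 <= c <= h -> differentiable F (c *: u + p).
  move=> c0h; apply: differentiableB; last first.
    by have := dF f c 0 c0h zh fU; rewrite -shiftE.
  apply: (@differentiable_comp _ _ _ _ (fun q => q + h *: v)).
    by apply: differentiableD; [exact: ex_diff | exact: differentiable_cst].
  by rewrite -addrA [p + _]addrC; exact: dF.
have [c c0h Fc] := MVT_line F p u h h0 diffF.
have FcE : 'D_u F (c *: u + p) =
    'D_u f (h *: v + (c *: u + p)) - 'D_u f (c *: u + p).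
  have dh := derF c c0h h hh.
  have d0 := derF c c0h 0 zh.
  rewrite -shiftE in d0.
  (* F is written with a shift by 0 *: v so that derF applies to both of its
     terms. *)
  have -> : F = (fun q => f (q + h *: v)) - (fun q => f (q + 0 *: v)).
    by apply/funext => q; rewrite /F !fctE scale0r addr0.
  rewrite deriveB ?derive_val //.
  by rewrite [h *: v + (c *: u + p)]addrCA.
have [|d d0h Dd] := MVT_line ('D_u f) (c *: u + p) v h h0.
  move=> d d0h; rewrite addrCA; apply: dF => //; exact: smooth_in_derive.
exists c, d; split; [exact: c0h|exact: d0h|].
have -> : c *: u + (d *: v + p) = d *: v + (c *: u + p) by rewrite addrCA.
rewrite expr2 -mulrA -Dd -FcE -Fc /F.
have -> : h *: u + (h *: v + p) = h *: u + p + h *: v.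
  by rewrite [h *: v + p]addrC addrA.
by rewrite [h *: v + p]addrC; ring.
Qed.

(** Symmetry of second derivatives. The second difference is symmetric in [u] and
    [v], so both iterated derivatives take a common value at points arbitrarily
    near [p]; both are continuous at [p]. *)
Lemma derive_commute {R : realType} {V : normedModType R} (U : set V)
    (f : V -> R) (p u v : V) : open U -> U p -> smooth_in U f ->
  'D_v ('D_u f) p = 'D_u ('D_v f) p.
Proof.
move=> oU Up fU; apply/eqP; rewrite -subr_eq0 -normr_le0.
apply/ler_addgt0Pr => e e0; rewrite add0r.
have e20 : 0 < e / 2 by rewrite divr_gt0.
have near_p (g : V -> R) : smooth_in U g -> \forall q \near p, `|g p - g q| < e / 2.
  move=> gU; have /cvgrPdist_lt := differentiable_continuous (smooth_in_differentiable gU Up).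
  exact.
have fvu := near_p _ (smooth_in_derive v (smooth_in_derive u fU)).
have fuv := near_p _ (smooth_in_derive u (smooth_in_derive v fU)).
have Up' : \forall q \near p, U q by exact: open_nbhs_nbhs.
have [r r0 rP] : exists2 r, 0 < r & forall q, `|p - q| < r ->
   [/\ U q, `|'D_v ('D_u f) p - 'D_v ('D_u f) q| < e / 2 &
     `|'D_u ('D_v f) p - 'D_u ('D_v f) q| < e / 2].
  have /nbhs_ballP[r r0 rP] : \forall q \near p,
      [/\ U q, `|'D_v ('D_u f) p - 'D_v ('D_u f) q| < e / 2 &
        `|'D_u ('D_v f) p - 'D_u ('D_v f) q| < e / 2].
    apply: (filterS3 _ _ Up' fvu fuv) => q Uq qu qv.
    split; [exact: Uq|exact: qu|exact: qv].
  by exists r => // q pq; apply: rP; rewrite -ball_normE.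
(* The side h keeps the parallelogram in the ball of radius r around p; adding 1
   covers the case where u and v both vanish. *)
pose h := r / (2 * (`|u| + `|v| + 1)).
have uv0 : 0 < `|u| + `|v| + 1.
  by rewrite ltr_wpDl ?ltr01 ?addr_ge0.
have h0 : 0 < h by rewrite divr_gt0 ?mulr_gt0.
have hr (c d : R) : 0 <= c <= h -> 0 <= d <= h -> `|p - (c *: u + (d *: v + p))| < r.
  move=> /andP[c0 ch] /andP[d0 dh].
  rewrite addrA opprD addrCA subrr addr0 normrN.
  apply: le_lt_trans (ler_normD _ _) _.
  rewrite !normrZ !ger0_norm//.
  apply: (@le_lt_trans _ _ (h * (`|u| + `|v| + 1))).
    rewrite mulrDr mulr1 mulrDr.
    have := ler_wpM2r (normr_ge0 u) ch; have := ler_wpM2r (normr_ge0 v) dh.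
    lra.
  rewrite /h invfM mulrA -mulrA mulVf ?gt_eqF// mulr1.
  by rewrite ltr_pdivrMr// ltr_pMr// ltr1n.
have [|c [d [c0h d0h E1]]] := second_difference U f p u v h h0 fU.
  by move=> c d c0h d0h; have [] := rP _ (hr _ _ c0h d0h).
have [|c' [d' [c0h' d0h' E2]]] := second_difference U f p v u h h0 fU.
  move=> c' d' c0h' d0h'; rewrite addrCA.
  by have [] := rP _ (hr _ _ d0h' c0h').
have E : 'D_v ('D_u f) (c *: u + (d *: v + p)) =
    'D_u ('D_v f) (d' *: u + (c' *: v + p)).
  have h20 : h ^+ 2 != 0 by rewrite expf_neq0 ?gt_eqF.
  have -> : d' *: u + (c' *: v + p) = c' *: v + (d' *: u + p) by rewrite addrCA.
  apply: (mulfI h20); apply: etrans (esym E1) _; apply: etrans _ E2.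
  have -> : h *: v + (h *: u + p) = h *: u + (h *: v + p) by rewrite addrCA.
  by congr (_ + _); rewrite addrAC.
have [_ A _] := rP _ (hr _ _ c0h d0h).
have [_ _ B] := rP _ (hr _ _ d0h' c0h').
rewrite E in A; exact: dist_le_of_halves A B.
Qed.

(** * The half chord and its derivatives *)

Lemma is_derive_div {R : realType} {V : normedModType R} (f g : V -> R)
    (p v : V) (df dg : R) : g p != 0 ->
  is_derive p v f df -> is_derive p v g dg ->
  is_derive p v (fun q => f q / g q) ((df * g p - f p * dg) / g p ^+ 2).
Proof.
move=> g0 Df Dg.
have DV : is_derive p v (fun q => (g q)^-1) (- (g p) ^- 2 *: dg).
  have [gd gE] := Dg; apply: DeriveDef; first exact: derivableV.
  by rewrite deriveV// gE.
have -> : (fun q => f q / g q) = f * (fun q => (g q)^-1) by [].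
apply: is_derive_eq; rewrite /GRing.scale/=.
by field.
Qed.

Lemma is_derive_s {R : realType} {W : normedModType R} (f : R * R -> W)
    (s t : R) (df : W) :
  is_derive ((s, t) : R * R) (1, 0) f df ->
  is_derive s 1 (fun r : R => f (r, t)) df.
Proof.
move=> Df.
have := @is_derive_affine_precomp R (R * R)%type R^o W (fun r => (r, t))
  (fun r => (r, 0)) f s 1 df.
apply => // h w b; congr (_, _).
by rewrite /= scaler0 add0r.
Qed.

Lemma is_derive_t {R : realType} {W : normedModType R} (f : R * R -> W)
    (s t : R) (df : W) :
  is_derive ((s, t) : R * R) (0, 1) f df ->
  is_derive t 1 (fun r : R => f (s, r)) df.
Proof.
move=> Df.
have := @is_derive_affine_precomp R (R * R)%type R^o W (fun r => (s, r))
  (fun r => (0, r)) f t 1 df.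
apply => // h w b; congr (_, _).
by rewrite /= scaler0 add0r.
Qed.

Definition jacobian {R : realType} (x y : R * R -> R) (p : R * R) : R :=
  ds x p * dt y p - dt x p * ds y p.

(** With [w] the vector of coordinates [chord_coord x y g x] and
    [chord_coord x y g y], this is Cramer's rule for the system
    [w, X_s] = g_s, [w, X_t] = g_t, where X = (x, y) and the bracket is the
    determinant in the plane. For an area distance, w is half the chord from
    alpha to beta. *)
Definition chord_coord {R : realType} (x y g a : R * R -> R) (p : R * R) : R :=
  (dt g p * ds a p - ds g p * dt a p) / jacobian x y p.

(** The determinant of (X_s, g_s), (X_t, g_t) and the second derivative of (X, g)
    along [v], where X = (x, y): the coefficients L and N of the surface (X, g) when
    [v] is a coordinate direction. *)
Definition second_coef {R : realType} (x y g : R * R -> R) (v p : R * R) : R :=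
  ds x p * (dt y p * 'D_v ('D_v g) p - dt g p * 'D_v ('D_v y) p)
  - ds y p * (dt x p * 'D_v ('D_v g) p - dt g p * 'D_v ('D_v x) p)
  + ds g p * (dt x p * 'D_v ('D_v y) p - dt y p * 'D_v ('D_v x) p).

Lemma is_derive_partial {R : realType} {V : normedModType R} {U : set V}
    {f : V -> R} {p : V} (u v : V) :
  smooth_in U f -> U p -> is_derive p v ('D_u f) ('D_v ('D_u f) p).
Proof.
move=> fU Up; apply: is_derive_differentiable.
exact: smooth_in_differentiable (smooth_in_derive u fU) Up.
Qed.

(** Stated for arbitrary functions in place of the partial derivatives, so that
    each of the two directions and coordinates below only substitutes the values
    of the second derivatives. *)
Lemma is_derive_chord {R : realType} {V : normedModType R}
    (as_ at_ gs gt xs xt ys yt : V -> R) (p v : V)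
    (das dat dgs dgt dxs dxt dys dyt : R) :
  xs p * yt p - xt p * ys p != 0 ->
  is_derive p v as_ das -> is_derive p v at_ dat ->
  is_derive p v gs dgs -> is_derive p v gt dgt ->
  is_derive p v xs dxs -> is_derive p v xt dxt ->
  is_derive p v ys dys -> is_derive p v yt dyt ->
  is_derive p v
    (fun q => (gt q * as_ q - gs q * at_ q) / (xs q * yt q - xt q * ys q))
    (((gt p * das + dgt * as_ p - (gs p * dat + dgs * at_ p)) *
      (xs p * yt p - xt p * ys p) - (gt p * as_ p - gs p * at_ p) *
      (xs p * dyt + dxs * yt p - (xt p * dys + dxt * ys p)))
     / (xs p * yt p - xt p * ys p) ^+ 2).
Proof.
move=> J0 *.
have := @is_derive_div R V (gt * as_ - gs * at_) (xs * yt - xt * ys) p v.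
move=> /(_ _ _ J0); apply.
  by apply: is_derive_eq; rewrite /GRing.scale/=; ring.
by apply: is_derive_eq; rewrite /GRing.scale/=; ring.
Qed.

(** The quotient rule in the direction s, once X_st = 0 and g_st = -J are put in;
    the hypothesis is what L = 0 contributes. *)
Lemma chord_quotient_s {R : realType}
    (a_s a_t gs gt xs xt ys yt ass gss xss yss : R) :
  xs * yt - xt * ys != 0 ->
  (gt * ass - gss * a_t) * (xs * yt - xt * ys) =
    (gt * a_s - gs * a_t) * (xss * yt - xt * yss) ->
  ((gt * ass + - (xs * yt - xt * ys) * a_s - (gs * 0 + gss * a_t)) *
    (xs * yt - xt * ys) - (gt * a_s - gs * a_t) *
      (xs * 0 + xss * yt - (xt * yss + 0 * ys)))
   / (xs * yt - xt * ys) ^+ 2 = - a_s.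
Proof.
move=> J0 E.
set J := xs * yt - xt * ys in J0 E *.
have -> : (gt * ass + - J * a_s - (gs * 0 + gss * a_t)) * J -
    (gt * a_s - gs * a_t) * (xs * 0 + xss * yt - (xt * yss + 0 * ys)) =
    - a_s * J ^+ 2 + ((gt * ass - gss * a_t) * J -
      (gt * a_s - gs * a_t) * (xss * yt - xt * yss)) by ring.
by rewrite E subrr addr0 mulfK// expf_neq0.
Qed.

Lemma chord_quotient_t {R : realType}
    (a_s a_t gs gt xs xt ys yt att gtt xtt ytt : R) :
  xs * yt - xt * ys != 0 ->
  (gtt * a_s - gs * att) * (xs * yt - xt * ys) =
    (gt * a_s - gs * a_t) * (xs * ytt - xtt * ys) ->
  ((gt * 0 + gtt * a_s - (gs * att + - (xs * yt - xt * ys) * a_t)) *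
    (xs * yt - xt * ys) - (gt * a_s - gs * a_t) *
      (xs * ytt + 0 * yt - (xt * 0 + xtt * ys)))
   / (xs * yt - xt * ys) ^+ 2 = a_t.
Proof.
move=> J0 E.
set J := xs * yt - xt * ys in J0 E *.
have -> : (gt * 0 + gtt * a_s - (gs * att + - J * a_t)) * J -
    (gt * a_s - gs * a_t) * (xs * ytt + 0 * yt - (xt * 0 + xtt * ys)) =
    a_t * J ^+ 2 + ((gtt * a_s - gs * att) * J -
      (gt * a_s - gs * a_t) * (xs * ytt - xtt * ys)) by ring.
by rewrite E subrr addr0 mulfK// expf_neq0.
Qed.

(** Each identity is, up to a factor, the vanishing determinant itself: the two
    sides differ by an entry of the first two rows times that determinant. *)
Lemma coplanar_minors {R : realType} (xs ys gs xt yt gt a b c : R) :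
  xs * (yt * c - gt * b) - ys * (xt * c - gt * a) + gs * (xt * b - yt * a) = 0 ->
  [/\ (gt * a - c * xt) * (xs * yt - xt * ys) =
       (gt * xs - gs * xt) * (a * yt - xt * b),
      (gt * b - c * yt) * (xs * yt - xt * ys) =
       (gt * ys - gs * yt) * (a * yt - xt * b),
      (c * xs - gs * a) * (xs * yt - xt * ys) =
       (gt * xs - gs * xt) * (xs * b - a * ys) &
      (c * ys - gs * b) * (xs * yt - xt * ys) =
       (gt * ys - gs * yt) * (xs * b - a * ys)].
Proof.
set D := (X in X = 0) => D0.
have zero k A B : A = B + k * D -> A = B by rewrite D0 mulr0 addr0.
by split; [apply: (zero (- xt))|apply: (zero (- yt))|apply: (zero xs)
  |apply: (zero ys)]; rewrite /D; ring.
Qed.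

(** Differentiating [w, X_s] = g_s and [w, X_t] = g_t along s gives [w_s, X_s] = 0,
    by L = 0, and [w_s, X_t] = g_st = [X_t, X_s]; hence w_s = - X_s. The computation
    is done on the explicit formula for w because w must first be known to have
    derivatives. *)
Lemma chord_ds {R : realType} (U : set (R * R)) (x y g : R * R -> R)
    (p : R * R) :
  open U -> U p -> smooth_in U x -> smooth_in U y -> smooth_in U g ->
  jacobian x y p != 0 -> dt (ds x) p = 0 -> dt (ds y) p = 0 ->
  dt (ds g) p = - jacobian x y p -> second_coef x y g (1, 0) p = 0 ->
  is_derive p (1, 0) (chord_coord x y g x) (- ds x p) /\
  is_derive p (1, 0) (chord_coord x y g y) (- ds y p).
Proof.
move=> oU Up xU yU gU J0 xst yst gst.
rewrite /jacobian in J0 gst.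
have Dss (f : R * R -> R) (fU : smooth_in U f) :=
  is_derive_partial ((1, 0) : R * R) (1, 0) fU Up.
have Dst (f : R * R -> R) (fU : smooth_in U f) :=
  is_derive_partial ((0, 1) : R * R) (1, 0) fU Up.
have Dts (f : R * R -> R) (fU : smooth_in U f) : is_derive p (1, 0) (dt f) (dt (ds f) p).
  have e := derive_commute U f p (1, 0) (0, 1) oU Up fU.
  exact: (is_derive_eq (Dst f fU) (esym e)).
have Dxt := Dts x xU; rewrite xst in Dxt.
have Dyt := Dts y yU; rewrite yst in Dyt.
have Dgt := Dts g gU; rewrite gst in Dgt.
move=> /coplanar_minors[e1 e2 _ _].
split.
- have D := is_derive_chord _ _ _ _ _ _ _ _ _ _ _ _ _ _ _ _ _ _ J0
    (Dss x xU) Dxt (Dss g gU) Dgt (Dss x xU) Dxt (Dss y yU) Dyt.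
  apply: (is_derive_eq D); exact: chord_quotient_s J0 e1.
- have D := is_derive_chord _ _ _ _ _ _ _ _ _ _ _ _ _ _ _ _ _ _ J0
    (Dss y yU) Dyt (Dss g gU) Dgt (Dss x xU) Dxt (Dss y yU) Dyt.
  apply: (is_derive_eq D); exact: chord_quotient_s J0 e2.
Qed.

(** The counterpart of [chord_ds] along t: here N = 0 gives [w_t, X_t] = 0, and
    [w_t, X_s] = [X_t, X_s], so w_t = X_t. *)
Lemma chord_dt {R : realType} (U : set (R * R)) (x y g : R * R -> R)
    (p : R * R) :
  U p -> smooth_in U x -> smooth_in U y -> smooth_in U g ->
  jacobian x y p != 0 -> dt (ds x) p = 0 -> dt (ds y) p = 0 ->
  dt (ds g) p = - jacobian x y p -> second_coef x y g (0, 1) p = 0 ->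
  is_derive p (0, 1) (chord_coord x y g x) (dt x p) /\
  is_derive p (0, 1) (chord_coord x y g y) (dt y p).
Proof.
move=> Up xU yU gU J0 xst yst gst.
rewrite /jacobian in J0 gst.
have Dtt (f : R * R -> R) (fU : smooth_in U f) :=
  is_derive_partial ((0, 1) : R * R) (0, 1) fU Up.
have Dts (f : R * R -> R) (fU : smooth_in U f) :
  is_derive p (0, 1) (ds f) (dt (ds f) p) := is_derive_partial ((1, 0) : R * R) (0, 1) fU Up.
have Dxs := Dts x xU; rewrite xst in Dxs.
have Dys := Dts y yU; rewrite yst in Dys.
have Dgs := Dts g gU; rewrite gst in Dgs.
move=> /coplanar_minors[_ _ e3 e4].
split.
- have D := is_derive_chord _ _ _ _ _ _ _ _ _ _ _ _ _ _ _ _ _ _ J0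
    Dxs (Dtt x xU) Dgs (Dtt g gU) Dxs (Dtt x xU) Dys (Dtt y yU).
  apply: (is_derive_eq D); exact: chord_quotient_t J0 e3.
- have D := is_derive_chord _ _ _ _ _ _ _ _ _ _ _ _ _ _ _ _ _ _ J0
    Dys (Dtt y yU) Dgs (Dtt g gU) Dxs (Dtt x xU) Dys (Dtt y yU).
  apply: (is_derive_eq D); exact: chord_quotient_t J0 e4.
Qed.

Lemma smooth_in_coord {R : realType} {V : normedModType R} {n : nat}
    (U : set V) (f : V -> 'rV[R]_n) (i : 'I_n) :
  open U -> smooth_in U f -> smooth_in U (fun p => f p 0 i).
Proof.
move=> oU fU; have [l lE lc] := @rV_coord_linear R n i.
have <- : l \o f = fun p => f p 0 i by apply/funext => p; exact: lE.
exact: smooth_in_linear.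
Qed.

Lemma iter_derive_coord {R : realType} {V : normedModType R} {n : nat}
    (U : set V) (f : V -> 'rV[R]_n) (i : 'I_n) (vs : seq V) (p : V) :
  open U -> smooth_in U f -> U p ->
  iter_derive vs f p 0 i = iter_derive vs (fun p => f p 0 i) p.
Proof.
move=> oU fU Up; have [l lE lc] := @rV_coord_linear R n i.
have <- : l \o f = fun p => f p 0 i by apply/funext => q; exact: lE.
by rewrite -lE; apply/esym; exact: iter_derive_linear oU fU _ _ Up.
Qed.

(** * Integration over the rectangle *)

(** The mixed derivative vanishes only on the rectangle, which need not be open, so
    every integration is along a coordinate segment contained in it. *)
Lemma separated_variables {R : realType} (I1 I2 : set R) (U : set (R * R))
    (x : R * R -> R) :
  is_interval I1 -> is_interval I2 -> open U -> I1 `*` I2 `<=` U ->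
  smooth_in U x -> (forall p, (I1 `*` I2) p -> dt (ds x) p = 0) ->
  forall s0 s t0 t, I1 s0 -> I1 s -> I2 t0 -> I2 t ->
  [/\ ds x (s, t) = ds x (s, t0), dt x (s, t) = dt x (s0, t) &
      x (s, t) = x (s, t0) + x (s0, t) - x (s0, t0)].
Proof.
move=> itv1 itv2 oU DU xU xst.
have dsx r t t' : I1 r -> I2 t -> I2 t' -> ds x (r, t) = ds x (r, t').
  move=> Ir; apply: (is_derive0_interval_cst I2 (fun t => ds x (r, t)) itv2).
  move=> c Ic; apply: is_derive_t.
  have Dp : (I1 `*` I2) (r, c) by split.
  have D := is_derive_partial ((1, 0) : R * R) (0, 1) xU (DU _ Dp).
  exact: (is_derive_eq D (xst _ Dp)).
have dtx r r' t : I2 t -> I1 r -> I1 r' -> dt x (r, t) = dt x (r', t).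
  move=> It; apply: (is_derive0_interval_cst I1 (fun r => dt x (r, t)) itv1).
  move=> c Ic; apply: is_derive_s.
  have Dp : (I1 `*` I2) (c, t) by split.
  have D := is_derive_partial ((0, 1) : R * R) (1, 0) xU (DU _ Dp).
  have e := derive_commute U x (c, t) (1, 0) (0, 1) oU (DU _ Dp) xU.
  exact: (is_derive_eq D (etrans (esym e) (xst _ Dp))).
move=> s0 s t0 t Is0 Is It0 It; split; [exact: dsx|exact: dtx|].
have Dx r c : I1 r -> I2 c -> is_derive r 1 (fun r => x (r, c)) (ds x (r, c)).
  move=> Ir Ic; apply: is_derive_s; apply: is_derive_differentiable.
  by apply: smooth_in_differentiable xU _; apply: DU.
have := @is_derive0_interval_cst R I1
  ((fun r => x (r, t)) - (fun r => x (r, t0))) itv1 _ s s0 Is Is0.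
rewrite !fctE => E.
suff : x (s, t) - x (s, t0) = x (s0, t) - x (s0, t0) by lra.
apply: E => r Ir.
have D1 := Dx r t Ir It; have D2 := Dx r t0 Ir It0.
have D := is_deriveB D1 D2.
by apply: (is_derive_eq D); rewrite (dsx r t t0)// subrr.
Qed.

(** Along s the sum w + x is constant, along t the difference w - x is constant;
    the separated form of x combines the two. *)
Lemma chord_integrated {R : realType} (I1 I2 : set R) (U : set (R * R))
    (x w : R * R -> R) :
  is_interval I1 -> is_interval I2 -> open U -> I1 `*` I2 `<=` U ->
  smooth_in U x -> (forall p, (I1 `*` I2) p -> dt (ds x) p = 0) ->
  (forall p, (I1 `*` I2) p -> is_derive p (1, 0) w (- ds x p)) ->
  (forall p, (I1 `*` I2) p -> is_derive p (0, 1) w (dt x p)) ->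
  forall s0 s t0 t, I1 s0 -> I1 s -> I2 t0 -> I2 t ->
  w (s, t) = x (s0, t) - x (s, t0) + w (s0, t0).
Proof.
move=> itv1 itv2 oU DU xU xst ws wt s0 s t0 t Is0 Is It0 It.
have [_ _ xE] := separated_variables I1 I2 U x itv1 itv2 oU DU xU xst
  s0 s t0 t Is0 Is It0 It.
have dx p v : (I1 `*` I2) p -> is_derive p v x ('D_v x p).
  move=> Dp; apply: is_derive_differentiable.
  by apply: smooth_in_differentiable xU _; apply: DU.
have Es : (w + x) (s, t) = (w + x) (s0, t).
  apply: (is_derive0_interval_cst I1 (fun r => (w + x) (r, t)) itv1) => //.
  move=> r Ir; apply: is_derive_s.
  have Dp : (I1 `*` I2) (r, t) by split.
  have D := is_deriveD (ws _ Dp) (dx _ (1, 0) Dp).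
  by apply: (is_derive_eq D); rewrite addNr.
have Et : (w - x) (s0, t) = (w - x) (s0, t0).
  apply: (is_derive0_interval_cst I2 (fun r => (w - x) (s0, r)) itv2) => //.
  move=> r Ir; apply: is_derive_t.
  have Dp : (I1 `*` I2) (s0, r) by split.
  have D := is_deriveB (wt _ Dp) (dx _ (0, 1) Dp).
  by apply: (is_derive_eq D); rewrite subrr.
move: Es Et; rewrite !fctE xE; lra.
Qed.

(** * Recovering the pair of plane curves *)

Lemma chord_solves_gradient {R : realType} (x y g : R * R -> R) (p : R * R) :
  jacobian x y p != 0 ->
  ds g p = chord_coord x y g x p * ds y p - chord_coord x y g y p * ds x p /\
  dt g p = chord_coord x y g x p * dt y p - chord_coord x y g y p * dt x p.
Proof.
rewrite /chord_coord; move J : (jacobian x y p) => j j0.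
have jE : ds x p * dt y p - dt x p * ds y p = j by rewrite -J.
by split; rewrite ![_ / j * _]mulrAC -mulrBl; apply: (canRL (mulfK j0));
  rewrite -jE; ring.
Qed.

Lemma dotp_perp {R : realType} (a : R) (u v : 'rV[R]_2) :
  dotp (a *: perp u) v = (a * u 0 0) * v 0 1 - (a * u 0 1) * v 0 0.
Proof.
rewrite /dotp /perp /vec2 !big_ord_recl big_ord0 !mxE /= addr0.
have -> : lift ord0 ord0 = 1 :> 'I_2 by exact: val_inj.
by rewrite -[ord0]/(0 : 'I_2); ring.
Qed.

Lemma smooth_on_subset {R : realType} {V W : normedModType R} (A B : set V)
    (f : V -> W) : A `<=` B -> smooth_on B f -> smooth_on A f.
Proof.
by move=> AB [U [oU BU fU]]; exists U; split => //; exact: subset_trans BU.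
Qed.

(** Each summand depends on one variable only, so it contributes the zero vector as
    direction of derivation in the other. *)
Lemma is_derive_separated_sum {R : realType} {W : normedModType R}
    (f : R * R -> W) (c : W) (s0 t0 : R) (p : R * R) :
  differentiable f (p.1, t0) -> differentiable f (s0, p.2) ->
  is_derive p (1, 0) (fun q => f (q.1, t0) + f (s0, q.2) + c)
    (ds f (p.1, t0)) /\
  is_derive p (0, 1) (fun q => f (q.1, t0) + f (s0, q.2) + c)
    (dt f (s0, p.2)).
Proof.
move=> df1 df2.
have der0 q : is_derive q (0 : R * R) f 0.
  by apply: DeriveDef; [exact: derivable0|exact: derive0].
have D1 (v : R * R) d : is_derive ((p.1, t0) : R * R) (v.1, 0) f d ->
    is_derive p v (fun q => f (q.1, t0)) d.
  apply: (@is_derive_affine_precomp R (R * R)%type (R * R)%type W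
    (fun q => (q.1, t0)) (fun q => (q.1, 0)) f p v d).
  by move=> h w q; congr (_, _); rewrite /= scaler0 add0r.
have D2 (v : R * R) d : is_derive ((s0, p.2) : R * R) (0, v.2) f d ->
    is_derive p v (fun q => f (s0, q.2)) d.
  apply: (@is_derive_affine_precomp R (R * R)%type (R * R)%type W
    (fun q => (s0, q.2)) (fun q => (0, q.2)) f p v d).
  by move=> h w q; congr (_, _); rewrite /= scaler0 add0r.
have Dc v : is_derive p v (fun=> c : W) 0 by exact: is_derive_cst.
split.
- have Ds := D1 (1, 0) _ (is_derive_differentiable ((1, 0) : R * R) df1).
  have Dt := D2 (1, 0) _ (der0 (s0, p.2)).
  by apply: (is_derive_eq (is_deriveD (is_deriveD Ds Dt) (Dc (1, 0))));
    rewrite !addr0.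
- have Ds := D1 (0, 1) _ (der0 (p.1, t0)).
  have Dt := D2 (0, 1) _ (is_derive_differentiable ((0, 1) : R * R) df2).
  by apply: (is_derive_eq (is_deriveD (is_deriveD Ds Dt) (Dc (0, 1))));
    rewrite addr0 add0r.
Qed.

(** The heart of the matter. Since w_s = - X_s and w_t = X_t, the curve
    alpha = X - w depends on s only, beta = X + w on t only, and w is half their
    chord, so that [w, X_s] = g_s and [w, X_t] = g_t say that the gradient of g is
    the rotated half chord. Along the coordinate lines through a base point the
    curves are 2 X up to constants; defining them so makes their smoothness
    immediate. *)
Lemma area_distance_of_planar_data {R : realType} (I1 I2 : set R)
    (z : R * R -> 'rV[R]_2) (g : R * R -> R) :
  let x := fun p => z p 0 0 in
  let y := fun p => z p 0 1 in
  nondegenerate_interval I1 -> nondegenerate_interval I2 ->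
  forall U, open U -> I1 `*` I2 `<=` U -> smooth_in U z -> smooth_in U g ->
  (forall p, (I1 `*` I2) p ->
    [/\ jacobian x y p != 0, dt (ds z) p = 0, dt (ds g) p = - jacobian x y p,
        second_coef x y g (1, 0) p = 0 & second_coef x y g (0, 1) p = 0]) ->
  exists alpha beta : R -> 'rV[R]_2,
    [/\ smooth_on I1 alpha, smooth_on I2 beta,
        is_area_function alpha beta I1 I2 g &
        forall p, (I1 `*` I2) p -> midpoint alpha beta p = z p].
Proof.
move=> x y [itv1 [s0 [_ [Is0 _ _]]]] [itv2 [t0 [_ [It0 _ _]]]] U oU DU zU gU H.
have xU : smooth_in U x by exact: smooth_in_coord.
have yU : smooth_in U y by exact: smooth_in_coord.
have zU0 i : smooth_in U (fun p => z p 0 i) by exact: smooth_in_coord.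
have zst i p : (I1 `*` I2) p -> dt (ds (fun p => z p 0 i)) p = 0.
  move=> Dp; have [_ z0 _ _ _] := H p Dp.
  have e := iter_derive_coord U z i [:: (0, 1); (1, 0)] p oU zU (DU _ Dp).
  have z0i : dt (ds z) p 0 i = 0 by rewrite z0 mxE.
  exact: etrans (esym e) z0i.
have ws p : (I1 `*` I2) p -> is_derive p (1, 0) (chord_coord x y g x) (- ds x p) /\
    is_derive p (1, 0) (chord_coord x y g y) (- ds y p).
  move=> Dp; have [J0 _ gst L _] := H p Dp.
  by apply: (chord_ds U) => //; [exact: DU|exact: zst|exact: zst].
have wt p : (I1 `*` I2) p -> is_derive p (0, 1) (chord_coord x y g x) (dt x p) /\
    is_derive p (0, 1) (chord_coord x y g y) (dt y p).
  move=> Dp; have [J0 _ gst _ N] := H p Dp.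
  by apply: (chord_dt U) => //; [exact: DU|exact: zst|exact: zst].
(* The value of w at the base point (s0, t0) fixes the constants of the two curves,
   whose common translation is fixed by the position of the midpoint there. *)
pose w0 := vec2 (chord_coord x y g x (s0, t0)) (chord_coord x y g y (s0, t0)).
pose alpha s := 2 *: z (s, t0) + (- z (s0, t0) - w0).
pose beta t := 2 *: z (s0, t) + (- z (s0, t0) + w0).
have smooth_half (phi : R -> R * R) (L : R -> R * R) (I : set R) (c : 'rV[R]_2) :
    (forall (h : R) (w a : R), phi (h *: w + a) = h *: L w + phi a) ->
    (forall p : R, differentiable phi p) -> I `<=` phi @^-1` (I1 `*` I2) ->
    smooth_on I (fun s => 2 *: z (phi s) + c).
  move=> phiE dphi ID; apply: smooth_on_subset ID _.
  have zD : smooth_on (I1 `*` I2) z by exists U.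
  have zD2 := @smooth_on_affine_postcomp _ _ _ _ ( *:%R 2) c _ _
    (@scaler_continuous _ _ 2) zD.
  exact: (smooth_on_affine_precomp phi L _ _ phiE dphi zD2).
have midE p : midpoint alpha beta p = z (p.1, t0) + z (s0, p.2) - z (s0, t0).
  by rewrite /midpoint /alpha /beta; apply/rowP => i; rewrite !mxE; lra.
have chordE p : 2^-1 *: (beta p.2 - alpha p.1) = z (s0, p.2) - z (p.1, t0) + w0.
  rewrite /alpha /beta; apply/rowP => i; rewrite !mxE; lra.
exists alpha, beta; split.
- apply: (smooth_half (fun s => (s, t0)) (fun s => (s, 0))).
  + by move=> h w a; congr (_, _); rewrite /= scaler0 add0r.
  + by move=> s; apply: differentiable_pair; [exact: ex_diff|exact: differentiable_cst].
  + by move=> s Is; split.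
- apply: (smooth_half (fun t => (s0, t)) (fun t => (0, t))).
  + by move=> h w a; congr (_, _); rewrite /= scaler0 add0r.
  + by move=> s; apply: differentiable_pair; [exact: differentiable_cst|exact: ex_diff].
  + by move=> s Is; split.
- split; first by exists U.
  move=> [s t] Dp; have [Is It] := Dp. rewrite /= in Is It.
  have [J0 _ _ _ _] := H _ Dp.
  have [gs gt] := chord_solves_gradient x y g (s, t) J0.
  have Wx := chord_integrated I1 I2 U x _ itv1 itv2 oU DU xU (zst 0)
    (fun p Dp => (ws p Dp).1) (fun p Dp => (wt p Dp).1) s0 s t0 t Is0 Is It0 It.
  have Wy := chord_integrated I1 I2 U y _ itv1 itv2 oU DU yU (zst 1)
    (fun p Dp => (ws p Dp).2) (fun p Dp => (wt p Dp).2) s0 s t0 t Is0 Is It0 It.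
  have hc i : 2^-1 * (beta t - alpha s) 0 i = (z (s0, t) - z (s, t0) + w0) 0 i.
    by rewrite -(chordE (s, t)) [RHS]mxE.
  have cx : 2^-1 * (beta t - alpha s) 0 0 = chord_coord x y g x (s, t).
    by rewrite hc Wx /w0 /vec2 !mxE /=.
  have cy : 2^-1 * (beta t - alpha s) 0 1 = chord_coord x y g y (s, t).
    by rewrite hc Wy /w0 /vec2 !mxE /=.
  have [] := is_derive_separated_sum z (- z (s0, t0)) s0 t0 (s, t)
    (smooth_in_differentiable zU (DU (s, t0) (conj Is It0)))
    (smooth_in_differentiable zU (DU (s0, t) (conj Is0 It))).
  have -> : (fun q => z (q.1, t0) + z (s0, q.2) + - z (s0, t0)) =
    midpoint alpha beta by apply/funext => q; rewrite midE.
  move=> [_ dsm] [_ dtm].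
  have dsE i : ds (midpoint alpha beta) (s, t) 0 i = ds (fun p => z p 0 i) (s, t).
    rewrite /ds dsm.
    have e := iter_derive_coord U z i [:: (1, 0)] (s, t0) oU zU (DU (s, t0) (conj Is It0)).
    have [e' _ _] := separated_variables I1 I2 U _ itv1 itv2 oU DU (zU0 i)
      (zst i) s0 s t0 t Is0 Is It0 It.
    exact: etrans e (esym e').
  have dtE i : dt (midpoint alpha beta) (s, t) 0 i = dt (fun p => z p 0 i) (s, t).
    rewrite /dt dtm.
    have e := iter_derive_coord U z i [:: (0, 1)] (s0, t) oU zU (DU (s0, t) (conj Is0 It)).
    have [_ e' _] := separated_variables I1 I2 U _ itv1 itv2 oU DU (zU0 i)
      (zst i) s0 s t0 t Is0 Is It0 It.
    exact: etrans e (esym e').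
  split; rewrite /half_chord_perp dotp_perp [_.1]/= [_.2]/= cx cy.
  - apply: etrans gs _.
    by congr (_ * _ - _ * _); apply/esym; [exact: (dsE 1)|exact: (dsE 0)].
  - apply: etrans gt _.
    by congr (_ * _ - _ * _); apply/esym; [exact: (dtE 1)|exact: (dtE 0)].
- move=> [s t] [Is It]; rewrite midE /=; apply/rowP => i.
  have [_ _ E] := separated_variables I1 I2 U _ itv1 itv2 oU DU (zU0 i)
    (zst i) s0 s t0 t Is0 Is It0 It.
  by rewrite !mxE E.
Qed.

(** * Determinants in space *)

Lemma sum_ord3 {R : nmodType} (F : 'I_3 -> R) : \sum_(i < 3) F i = F 0 + F 1 + F 2.
Proof.
rewrite !big_ord_recl big_ord0 addr0 addrA.
by congr (F _ + F _ + F _); exact: val_inj.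
Qed.

Lemma det2E {R : realType} (B : 'M[R]_2) :
  \det B = B 0 0 * B 1 1 - B 0 1 * B 1 0.
Proof.
rewrite (expand_det_row _ 0) !big_ord_recl big_ord0 addr0 /cofactor !det_mx11 !mxE /=.
have -> : lift ord0 ord0 = 1 :> 'I_2 by exact: val_inj.
have -> : lift 1 0 = 0 :> 'I_2 by exact: val_inj.
rewrite -[ord0]/(0 : 'I_2). ring.
Qed.

Lemma det3E {R : realType} (u v w : 'rV[R]_3) :
  det3 u v w = u 0 0 * (v 0 1 * w 0 2 - v 0 2 * w 0 1)
    - u 0 1 * (v 0 0 * w 0 2 - v 0 2 * w 0 0)
    + u 0 2 * (v 0 0 * w 0 1 - v 0 1 * w 0 0).
Proof.
rewrite /det3 (expand_det_row _ 0) sum_ord3 /cofactor !det2E !mxE /=.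
have e0 : lift 0 0 = 1 :> 'I_3 by exact: val_inj.
have e1 : lift 0 1 = 2 :> 'I_3 by exact: val_inj.
have e2 : lift 1 0 = 0 :> 'I_3 by exact: val_inj.
have e3 : lift 1 1 = 2 :> 'I_3 by exact: val_inj.
have e4 : lift 2 0 = 0 :> 'I_3 by exact: val_inj.
have e5 : lift 2 1 = 1 :> 'I_3 by exact: val_inj.
by rewrite e0 e1 e2 e3 e4 e5; ring.
Qed.

Lemma det3_mulmx {R : realType} (A : 'M[R]_3) (u v w : 'rV[R]_3) :
  det3 (u *m A) (v *m A) (w *m A) = det3 u v w * \det A.
Proof.
rewrite /det3 -det_mulmx; congr (\det _); apply/row_matrixP => i.
rewrite row_mul !rowK.
have : [|| i == 0, i == 1 | i == 2] by case: i => [[|[|[|]]]].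
by case/or3P => /eqP->.
Qed.

(** The rows of A are two coordinate vectors, suitably scaled, and a row solved from
    xi *m A = (0, 0, 1), at the position of a nonzero coordinate of xi. *)
Lemma unimodular_frame {R : realType} (xi : 'rV[R]_3) : xi != 0 ->
  exists2 A : 'M[R]_3, \det A = 1 & xi *m A = vec3 0 0 1.
Proof.
move=> xi0.
have build (r0 r1 r2 : 'rV[R]_3) : det3 r0 r1 r2 = 1 ->
    xi 0 0 *: r0 + xi 0 1 *: r1 + xi 0 2 *: r2 = vec3 0 0 1 ->
    exists2 A : 'M[R]_3, \det A = 1 & xi *m A = vec3 0 0 1.
  move=> d1 e; exists (\matrix_(i < 3) [:: r0; r1; r2]`_i) => //.
  by rewrite mulmx_sum_row sum_ord3 !rowK.
have eqv (u v : 'rV[R]_3) : u 0 0 = v 0 0 -> u 0 1 = v 0 1 -> u 0 2 = v 0 2 -> u = v.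
  move=> h0 h1 h2; apply/rowP => i.
  have : [|| i == 0, i == 1 | i == 2] by case: i => [[|[|[|]]]].
  by case/or3P => /eqP->.
have [c0|c0] := eqVneq (xi 0 2) 0; last first.
  apply: (build (vec3 (xi 0 2) 0 0) (vec3 0 1 0)
    (vec3 (- xi 0 0) (- xi 0 1 / xi 0 2) (xi 0 2)^-1)).
    by rewrite det3E !mxE /=; field.
  by apply: eqv; rewrite !mxE /=; field.
have [b0|b0] := eqVneq (xi 0 1) 0; last first.
  apply: (build (vec3 (- xi 0 1) 0 0) (vec3 (xi 0 0) 0 (xi 0 1)^-1) (vec3 0 1 0)).
    by rewrite det3E !mxE /=; field.
  by apply: eqv; rewrite !mxE /= ?c0; field.
have a0 : xi 0 0 != 0.
  by apply: contra_neq xi0 => a0; apply: eqv; rewrite ?a0 ?b0 ?c0 mxE.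
apply: (build (vec3 0 0 (xi 0 0)^-1) (vec3 (xi 0 0) 0 0) (vec3 0 1 0)).
  by rewrite det3E !mxE /=; field.
by apply: eqv; rewrite !mxE /= ?c0 ?b0; field.
Qed.

(** * Surfaces with vertical affine normal *)

Lemma iter_derive_mulmx {R : realType} {V : normedModType R} {m n : nat}
    (U : set V) (f : V -> 'rV[R]_m) (A : 'M[R]_(m, n)) (vs : seq V) (p : V) :
  open U -> smooth_in U f -> U p ->
  iter_derive vs (fun p => f p *m A) p = iter_derive vs f p *m A.
Proof.
by move=> oU fU Up; exact: (iter_derive_linear (mulmxr A) U f
  (mulmxr_continuous A) oU fU vs p Up).
Qed.

Lemma smooth_in_mulmx {R : realType} {V : normedModType R} {m n : nat}
    (U : set V) (f : V -> 'rV[R]_m) (A : 'M[R]_(m, n)) :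
  open U -> smooth_in U f -> smooth_in U (fun p => f p *m A).
Proof. exact: (smooth_in_linear (mulmxr A) U f (mulmxr_continuous A)). Qed.

(** The matrix of the projection along the third axis. *)
Definition plane_mx {R : realType} : 'M[R]_(3, 2) :=
  \matrix_(i < 3, j < 2) (i == j :> nat)%:R.

Lemma mul_plane_mx {R : realType} (v : 'rV[R]_3) :
  (v *m plane_mx) 0 0 = v 0 0 /\ (v *m plane_mx) 0 1 = v 0 1.
Proof.
by rewrite !mxE !sum_ord3 !mxE /=; split; rewrite ?mulr0 ?mulr1 ?addr0 ?add0r.
Qed.

Lemma det3_vertical {R : realType} (u v : 'rV[R]_3) :
  det3 u v (vec3 0 0 1) = u 0 0 * v 0 1 - v 0 0 * u 0 1.
Proof. by rewrite det3E !mxE /=; ring. Qed.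

Lemma vertical_proj {R : realType} : vec3 0 0 1 *m plane_mx = 0 :> 'rV[R]_2.
Proof.
apply/rowP => i; rewrite !mxE sum_ord3 !mxE /=.
by case: i => [[|[|[]]]]//= _; rewrite !mul0r !mulr0 !addr0.
Qed.

(** For r = (X, g), the mixed derivative being vertical means X_st = 0, and its
    height gives g_st = - [X_s, X_t]. The minus sign is that of an area distance:
    there g_st = [X_t, X_s]. *)
Lemma area_distance_of_normalized_sphere {R : realType} (I1 I2 : set R)
    (r : R * R -> 'rV[R]_3) :
  nondegenerate_interval I1 -> nondegenerate_interval I2 ->
  smooth_on (I1 `*` I2) r ->
  (forall p, (I1 `*` I2) p ->
    [/\ det3 (ds r p) (dt r p) (vec3 0 0 1) != 0,
        dt (ds r) p = - det3 (ds r p) (dt r p) (vec3 0 0 1) *: vec3 0 0 1,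
        Lcoef r p = 0 & Ncoef r p = 0]) ->
  exists alpha beta : R -> 'rV[R]_2,
    [/\ smooth_on I1 alpha, smooth_on I2 beta &
        generalized_area_distance alpha beta I1 I2 r].
Proof.
move=> hI1 hI2 [U [oU DU rU]] H.
pose z p := r p *m plane_mx.
pose g p := r p 0 2.
have zU : smooth_in U z by exact: smooth_in_mulmx.
have gU : smooth_in U g by exact: smooth_in_coord.
have zx : (fun p => z p 0 0) = (fun p => r p 0 0).
  by apply/funext => p; exact: (mul_plane_mx (r p)).1.
have zy : (fun p => z p 0 1) = (fun p => r p 0 1).
  by apply/funext => p; exact: (mul_plane_mx (r p)).2.
have [|alpha [beta [al be ga mid]]] :=
  area_distance_of_planar_data I1 I2 z g hI1 hI2 U oU DU zU gU.
  rewrite zx zy => p Dp; have [d0 mst L N] := H p Dp; have Up := DU p Dp.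
  have xs i : ds (fun p => r p 0 i) p = ds r p 0 i :=
    esym (iter_derive_coord U r i [:: ((1, 0) : R * R)] p oU rU Up).
  have xt i : dt (fun p => r p 0 i) p = dt r p 0 i :=
    esym (iter_derive_coord U r i [:: ((0, 1) : R * R)] p oU rU Up).
  have xvv (v w : R * R) i :
      'D_w ('D_v (fun p => r p 0 i)) p = 'D_w ('D_v r) p 0 i :=
    esym (iter_derive_coord U r i [:: w; v] p oU rU Up).
  have jacobianE : jacobian (fun p => r p 0 0) (fun p => r p 0 1) p =
      det3 (ds r p) (dt r p) (vec3 0 0 1).
    by rewrite /jacobian (xs 0) (xs 1) (xt 0) (xt 1) det3_vertical.
  have second_coefE v : second_coef (fun p => r p 0 0) (fun p => r p 0 1) g v p =
      det3 (ds r p) (dt r p) ('D_v ('D_v r) p).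
    rewrite /second_coef (xs 0) (xs 1) (xs 2) (xt 0) (xt 1) (xt 2).
    by rewrite (xvv v v 0) (xvv v v 1) (xvv v v 2) det3E.
  split.
  - by rewrite jacobianE.
  - have e := iter_derive_mulmx U r plane_mx
      [:: ((0, 1) : R * R); ((1, 0) : R * R)] p oU rU Up.
    apply: etrans e _; apply: etrans (congr1 (mulmxr plane_mx) mst) _ => /=.
    by rewrite -scalemxAl vertical_proj scaler0.
  - apply: etrans (xvv _ _ 2) _.
    apply: etrans (congr1 (fun v : 'rV_3 => v 0 2) mst) _.
    by rewrite jacobianE !mxE /= mulr1.
  - exact: etrans (second_coefE (1, 0)) L.
  - exact: etrans (second_coefE (0, 1)) N.
exists alpha, beta; split => //; exists g; split => // p Dp.
rewrite mid// /z (mul_plane_mx (r p)).1 (mul_plane_mx (r p)).2.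
apply/rowP => i.
have : [|| i == 0, i == 1 | i == 2] by case: i => [[|[|[|]]]].
by case/or3P => /eqP->; rewrite mxE.
Qed.

(** A unimodular linear map preserves the determinants in the hypotheses, so the
    transformed surface is normalized with vertical xi. *)
Lemma area_distance_of_oriented_sphere {R : realType} (I1 I2 : set R)
    (q : R * R -> 'rV[R]_3) (xi : 'rV[R]_3) (A : 'M[R]_3) :
  nondegenerate_interval I1 -> nondegenerate_interval I2 ->
  smooth_on (I1 `*` I2) q -> \det A = 1 -> xi *m A = vec3 0 0 1 ->
  (forall p, (I1 `*` I2) p ->
    [/\ det3 (ds q p) (dt q p) xi != 0,
        dt (ds q) p = - det3 (ds q p) (dt q p) xi *: xi,
        Lcoef q p = 0 & Ncoef q p = 0]) ->
  exists alpha beta : R -> 'rV[R]_2,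
    [/\ smooth_on I1 alpha, smooth_on I2 beta &
        generalized_area_distance alpha beta I1 I2 (affine_map A 0 \o q)].
Proof.
move=> hI1 hI2 [U [oU DU qU]] A1 xiA H.
have -> : affine_map A 0 \o q = fun p => q p *m A.
  by apply/funext => p; rewrite /= /affine_map addr0.
apply: (area_distance_of_normalized_sphere I1 I2 _ hI1 hI2).
  by exists U; split => //; exact: smooth_in_mulmx.
move=> p Dp; have Up := DU p Dp; have [d0 mst L N] := H p Dp.
have rv (v : R * R) : 'D_v (fun p => q p *m A) p = 'D_v q p *m A :=
  iter_derive_mulmx U q A [:: v] p oU qU Up.
have rvw (v w : R * R) :
    'D_w ('D_v (fun p => q p *m A)) p = 'D_w ('D_v q) p *m A :=
  iter_derive_mulmx U q A [:: w; v] p oU qU Up.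
have detE : det3 (ds (fun p => q p *m A) p) (dt (fun p => q p *m A) p)
    (vec3 0 0 1) = det3 (ds q p) (dt q p) xi.
  by rewrite /ds /dt (rv (1, 0)) (rv (0, 1)) -xiA det3_mulmx A1 mulr1.
split.
- by rewrite detE.
- apply: etrans (rvw (1, 0) (0, 1)) _.
  by rewrite detE -xiA scalemxAl; congr (_ *m _).
- rewrite /Lcoef /ds /dt (rv (1, 0)) (rv (0, 1)) (rvw (1, 0) (1, 0)).
  rewrite det3_mulmx A1 mulr1; exact: L.
- rewrite /Ncoef /ds /dt (rv (1, 0)) (rv (0, 1)) (rvw (0, 1) (0, 1)).
  rewrite det3_mulmx A1 mulr1; exact: N.
Qed.

(** * Exchange of the parameters and the sign of M *)

Lemma exchange_affine {R : realType} (h : R) (w a : R * R) :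
  exchange (h *: w + a) = h *: exchange w + exchange a.
Proof. by []. Qed.

Lemma derive_exchange {R : realType} {W : normedModType R} (f : R * R -> W) :
  ds (f \o exchange) = dt f \o exchange /\
  dt (f \o exchange) = ds f \o exchange.
Proof.
by split; apply/funext => p;
  exact: (derive_affine_precomp exchange exchange f p _ exchange_affine).
Qed.

Lemma smooth_on_exchange {R : realType} {W : normedModType R} (I1 I2 : set R)
    (f : R * R -> W) :
  smooth_on (I1 `*` I2) f -> smooth_on (I2 `*` I1) (f \o exchange).
Proof.
move=> fD; apply: (@smooth_on_subset _ _ _ _ (exchange @^-1` (I1 `*` I2))).
  by move=> p [].
apply: (smooth_on_affine_precomp exchange exchange) fD.
  exact: exchange_affine.
move=> p; apply: differentiable_pair.
  by apply: (@linear_differentiable _ (R * R)%type R^o snd) => x; exact: cvg_snd.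
by apply: (@linear_differentiable _ (R * R)%type R^o fst) => x; exact: cvg_fst.
Qed.

Lemma derive_commute_rV {R : realType} {V : normedModType R} {n : nat}
    (U : set V) (f : V -> 'rV[R]_n) (p u v : V) :
  open U -> U p -> smooth_in U f -> 'D_v ('D_u f) p = 'D_u ('D_v f) p.
Proof.
move=> oU Up fU; apply/rowP => i.
apply: etrans (iter_derive_coord U f i [:: v; u] p oU fU Up) _.
apply: etrans _ (esym (iter_derive_coord U f i [:: u; v] p oU fU Up)).
apply: (derive_commute U) => //; exact: smooth_in_coord.
Qed.

(** The rectangle is convex: a change of sign would produce a zero on the segment
    between two of its points. *)
Lemma constant_sign {R : realType} (I1 I2 : set R)
    (M : R * R -> R) :
  is_interval I1 -> is_interval I2 ->
  (forall p, (I1 `*` I2) p -> differentiable M p) ->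
  (forall p, (I1 `*` I2) p -> M p != 0) ->
  (forall p, (I1 `*` I2) p -> 0 < M p) \/ (forall p, (I1 `*` I2) p -> M p < 0).
Proof.
move=> itv1 itv2 dM M0.
have same p p' : (I1 `*` I2) p -> (I1 `*` I2) p' -> 0 < M p -> 0 < M p'.
  move=> Dp Dp' Mp.
  rewrite ltNge; apply/negP => Mp'.
  have itv_conv (I : set R) a b c : is_interval I -> I a -> I b ->
      0 <= c <= 1 -> I (c * (b - a) + a).
    move=> itvI Ia Ib /andP[c0 c1]; case: (leP a b) => ab.
      by apply: (itvI _ _ Ia Ib); apply/andP; split; nra.
    by apply: (itvI _ _ Ib Ia); apply/andP; split; nra.
  have Dc c : 0 <= c <= 1 -> (I1 `*` I2) (c *: (p' - p) + p).
    move=> c01; case: Dp Dp' => ? ? [? ?].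
    by split; apply: itv_conv.
  pose h (c : R) := M (c *: (p' - p) + p).
  have ch : {within `[0, 1], continuous h}.
    apply: derivable_within_continuous => c; rewrite in_itv/= => c01.
    by have [] := is_derive_line M p (p' - p) c (dM _ (Dc c c01)).
  have h0 : h 0 = M p by rewrite /h scale0r add0r.
  have h1 : h 1 = M p' by rewrite /h scale1r subrK.
  have [|c c01 hc] := @IVT R h 0 1 0 ler01 ch.
    by rewrite h0 h1 ge_min le_max Mp' (ltW Mp) orbT.
  rewrite in_itv/= in c01.
  by have := M0 _ (Dc c c01); rewrite -/(h c) hc eqxx.
have [[p Dp Mp]|none] := pselect (exists2 p, (I1 `*` I2) p & 0 < M p).
  by left => p' Dp'; exact: same Dp Dp' Mp.
right => p Dp; rewrite lt_neqAle M0//= leNgt; apply/negP => Mp.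
by apply: none; exists p.
Qed.

Lemma det3_scaler {R : realType} (k : R) (u v w : 'rV[R]_3) :
  det3 u v (k *: w) = k * det3 u v w.
Proof. by rewrite !det3E !mxE; ring. Qed.

Lemma det3_swap {R : realType} (u v w : 'rV[R]_3) : det3 v u w = - det3 u v w.
Proof. by rewrite !det3E; ring. Qed.

Lemma differentiable_det3 {R : realType} {V : normedModType R}
    (u v w : V -> 'rV[R]_3) (p : V) :
  differentiable u p -> differentiable v p -> differentiable w p ->
  differentiable (fun q => det3 (u q) (v q) (w q)) p.
Proof.
move=> du dv dw.
have coord (f : V -> 'rV[R]_3) i : differentiable f p ->
    differentiable (fun q => f q 0 i) p.
  move=> df; apply: (@differentiable_comp _ _ _ _ f (fun N : 'rV_3 => N 0 i)) => //.
  exact: differentiable_coord.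
have u_ i := coord u i du; have v_ i := coord v i dv; have w_ i := coord w i dw.
under eq_fun do rewrite det3E.
have minor i j : differentiable
    (fun q => v q 0 i * w q 0 j - v q 0 j * w q 0 i) p.
  by apply: differentiableB; apply: differentiableM.
apply: differentiableD; first apply: differentiableB.
- exact: differentiableM (u_ 0) (minor 1 2).
- exact: differentiableM (u_ 1) (minor 0 2).
- exact: differentiableM (u_ 2) (minor 0 1).
Qed.

(** Here [m] stands for the mixed derivative, [k] for Omega and [sigma] for the sign
    of M. The right-hand side is quadratic in [xi], which is why the ambiguity in
    the sign of the affine normal disappears. *)
Lemma normal_reconstructs_mixed {R : realType} (u v m e xi : 'rV[R]_3)
    (k sigma : R) :
  0 < k -> sigma ^+ 2 = 1 -> k^-1 *: m = e -> e = xi \/ e = - xi ->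
  det3 u v m = sigma * k ^+ 2 ->
  m = (sigma * det3 u v xi) *: xi /\ det3 u v xi != 0.
Proof.
move=> k0 s1 me exi dm.
have mE : m = k *: e by rewrite -me scalerA mulfV ?gt_eqF// scale1r.
have k_neq0 : k != 0 by rewrite gt_eqF.
have de : det3 u v e = sigma * k.
  apply: (mulfI k_neq0); rewrite -det3_scaler -mE dm; ring.
have s0 : sigma != 0.
  by apply/eqP => s0; move: s1; rewrite s0 expr0n /= => /eqP; rewrite eq_sym oner_eq0.
have xiE : det3 u v xi *: xi = det3 u v e *: e.
  by case: exi => -> //; rewrite -scaleN1r det3_scaler !scalerA mulrAC mulrNN !mul1r.
split.
- by rewrite -scalerA xiE de scalerA mulrA -expr2 s1 mul1r.
- case: exi => exi.
    by rewrite -exi de mulf_neq0.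
  rewrite -[xi]opprK -exi -scaleN1r det3_scaler de.
  by rewrite mulN1r oppr_eq0 mulf_neq0.
Qed.

Lemma ltr0_sqr_sqrtrN {R : realType} (a : R) :
  a < 0 -> a = -1 * Num.sqrt (- a) ^+ 2.
Proof. by move=> a0; rewrite sqr_sqrtr ?oppr_ge0 ?ltW// mulN1r opprK. Qed.

Lemma mixed_exchange {R : realType} (q : R * R -> 'rV[R]_3) (p : R * R) :
  dt (ds (q \o exchange)) p = ds (dt q) (exchange p).
Proof. by rewrite (derive_exchange q).1 (derive_exchange (dt q)).2. Qed.

Lemma Lcoef_exchange {R : realType} (q : R * R -> 'rV[R]_3) (p : R * R) :
  Lcoef (q \o exchange) p = - Ncoef q (exchange p).
Proof.
rewrite /Lcoef (derive_exchange q).1 (derive_exchange q).2.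
by rewrite (derive_exchange (dt q)).1; exact: det3_swap.
Qed.

Lemma Ncoef_exchange {R : realType} (q : R * R -> 'rV[R]_3) (p : R * R) :
  Ncoef (q \o exchange) p = - Lcoef q (exchange p).
Proof.
rewrite /Ncoef (derive_exchange q).1 (derive_exchange q).2.
by rewrite (derive_exchange (ds q)).2; exact: det3_swap.
Qed.

Lemma det3_exchange {R : realType} (q : R * R -> 'rV[R]_3) (p : R * R)
    (w : 'rV[R]_3) :
  det3 (ds (q \o exchange) p) (dt (q \o exchange) p) w =
  - det3 (ds q (exchange p)) (dt q (exchange p)) w.
Proof.
by rewrite (derive_exchange q).1 (derive_exchange q).2; exact: det3_swap.
Qed.

Lemma exchangeK {R : realType} : involutive (@exchange R).
Proof. by case. Qed.

Theorem proposition3p3 (R : realType) (I1 I2 : set R)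
    (hI1 : nondegenerate_interval I1) (hI2 : nondegenerate_interval I2)
    (q : R * R -> 'rV[R]_3) (xi : 'rV[R]_3)
    (hq : indefinite_improper_affine_sphere (I1 `*` I2) q xi) :
  exists (A : 'M[R]_3) (b : 'rV[R]_3),
    [/\ \det A = 1,
        xi *m A = vec3 0 0 1,
        xi = vec3 0 0 1 -> A = 1%:M /\ b = 0 &
        (exists alpha beta : R -> 'rV[R]_2,
           [/\ smooth_on I1 alpha, smooth_on I2 beta &
               generalized_area_distance alpha beta I1 I2
                 (affine_map A b \o q)])
        \/
        (exists alpha beta : R -> 'rV[R]_2,
           [/\ smooth_on I2 alpha, smooth_on I1 beta &
               generalized_area_distance alpha beta I2 I1
                 (affine_map A b \o q \o exchange)])].
Proof.
case: hq => -[qD _] indef asym cnormal.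
have [U [oU DU qU]] := qD.
have qst p : U p -> ds (dt q) p = dt (ds q) p.
  move=> Up; apply/esym; exact: derive_commute_rV oU Up qU.
have normal p : (I1 `*` I2) p -> affine_normal q p = xi \/ affine_normal q p = - xi.
  by move=> Dp; case: cnormal => h; [left|right]; exact: h.
have M0 p : (I1 `*` I2) p -> Mcoef q p != 0.
  move=> Dp; apply/eqP => M0; have := indef p Dp; have [-> _] := asym p Dp.
  by rewrite M0 mul0r expr0n subrr ltxx.
have dM p : (I1 `*` I2) p -> differentiable (Mcoef q) p.
  move=> Dp; have Up := DU p Dp; apply: differentiable_det3.
  - exact: (qU [:: ((1, 0) : R * R)] p Up).
  - exact: (qU [:: ((0, 1) : R * R)] p Up).
  - exact: (qU [:: ((0, 1) : R * R); ((1, 0) : R * R)] p Up).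
have pos p : (I1 `*` I2) p -> 0 < Mcoef q p ->
    dt (ds q) p = det3 (ds q p) (dt q p) xi *: xi /\
    det3 (ds q p) (dt q p) xi != 0.
  move=> Dp Mp; have := normal p Dp; rewrite /affine_normal Mp => nE.
  have k0 : 0 < Num.sqrt (Mcoef q p) by rewrite sqrtr_gt0.
  have dE : det3 (ds q p) (dt q p) (dt (ds q) p) =
      1 * Num.sqrt (Mcoef q p) ^+ 2 by rewrite mul1r sqr_sqrtr ?ltW.
  have [mE d0] := normal_reconstructs_mixed _ _ _ _ xi _ 1 k0 (expr1n _ _)
    erefl nE dE.
  by split; [apply: etrans mE _; rewrite mul1r|exact: d0].
have neg p : (I1 `*` I2) p -> Mcoef q p < 0 ->
    dt (ds q) p = - det3 (ds q p) (dt q p) xi *: xi /\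
    det3 (ds q p) (dt q p) xi != 0.
  move=> Dp Mp; have := normal p Dp; rewrite /affine_normal ltNge ltW//=.
  have mixE : dt (ds (q \o exchange)) (exchange p) = dt (ds q) p.
    by rewrite mixed_exchange exchangeK; exact: qst _ (DU _ Dp).
  have ME : Mcoef (q \o exchange) (exchange p) = - Mcoef q p.
    by rewrite /Mcoef mixE det3_exchange exchangeK.
  rewrite /affine_normal_Mpos mixE ME => nE.
  have k0 : 0 < Num.sqrt (- Mcoef q p) by rewrite sqrtr_gt0 oppr_gt0.
  have dE : det3 (ds q p) (dt q p) (dt (ds q) p) =
      -1 * Num.sqrt (- Mcoef q p) ^+ 2 := ltr0_sqr_sqrtrN _ Mp.
  have s1 : (-1) ^+ 2 = 1 :> R by rewrite sqrrN expr1n.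
  have [mE d0] := normal_reconstructs_mixed _ _ _ _ xi _ (-1) k0 s1
    erefl nE dE.
  by split; [apply: etrans mE _; rewrite mulN1r|exact: d0].
have [itv1 [a1 [_ [Ia1 _ _]]]] := hI1; have [itv2 [a2 [_ [Ia2 _ _]]]] := hI2.
have sign := constant_sign I1 I2 (Mcoef q) itv1 itv2 dM M0.
have xi0 : xi != 0.
  have Da : (I1 `*` I2) (a1, a2) by split.
  have d0 : det3 (ds q (a1, a2)) (dt q (a1, a2)) xi != 0.
    by case: sign => s; [have [] := pos _ Da (s _ Da)|have [] := neg _ Da (s _ Da)].
  apply: contra_neq d0 => ->.
  by rewrite -(scale0r (0 : 'rV_3)) det3_scaler mul0r.
have [A [A1 xiA Aid]] : exists A : 'M[R]_3, [/\ \det A = 1, xi *m A = vec3 0 0 1 &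
    xi = vec3 0 0 1 -> A = 1%:M].
  have [->|ne] := eqVneq xi (vec3 0 0 1).
    by exists 1%:M; split; rewrite ?det1 ?mulmx1.
  have [A A1 xiA] := unimodular_frame xi xi0.
  by exists A; split => // e; rewrite e eqxx in ne.
exists A, 0; split => //; first by move=> e; split => //; exact: Aid.
case: sign => s.
(* For M > 0 the mixed derivative has the sign opposite to that of an area distance,
   and exchanging s and t reverses the bracket. *)
- right.
  apply: (area_distance_of_oriented_sphere I2 I1 (q \o exchange) xi A hI2 hI1
    (smooth_on_exchange I1 I2 q qD) A1 xiA).
  move=> p [Ip1 Ip2].
  have Dp : (I1 `*` I2) (exchange p) by split.
  have Up := DU _ Dp; have [mE d0] := pos _ Dp (s _ Dp).
  have [L N] := asym _ Dp.
  rewrite det3_exchange Lcoef_exchange Ncoef_exchange L N oppr0 oppr_eq0 opprK.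
  split; [exact: d0| |by []|by []].
  by apply: etrans (mixed_exchange q p) _; exact: etrans (qst _ Up) mE.
- left.
  apply: (area_distance_of_oriented_sphere I1 I2 q xi A hI1 hI2 qD A1 xiA).
  move=> p Dp; have [mE d0] := neg _ Dp (s _ Dp); have [L N] := asym _ Dp.
  by split.
Qed.
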